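(* (Linear ISS small-gain theorem in summation formulation.) Let $I$ be a nonempty countable index set, let $(X_i,\|\cdot\|_{X_i})$, $i\in I$, be normed spaces and let $\Sigma_i=(X_i,\mathrm{PC}_b(\mathbb{R}_+,X_{\neq i})\times\mathcal{U},\bar\phi_i)$, $i\in I$, be forward complete control systems. Assume that the interconnection $\Sigma=(X,\mathcal{U},\phi)$ of the systems $\Sigma_i$ is well-defined. Furthermore, assume: (i) Each system $\Sigma_i$ is ISS in summation formulation, with $\beta_i\in\mathcal{KL}$ and gains $\gamma_{ij},\gamma_i\in\mathcal{K}\cup\{0\}$ ($j\in I$). (ii) There are $\beta_{\max}\in\mathcal{KL}$ and $\gamma_{\max}\in\mathcal{K}$ such that $\beta_i\le\beta_{\max}$ and $\gamma_i\le\gamma_{\max}$ pointwise for all $i\in I$. (iii) All gains $\gamma_{ij}$, $i,j\in I$, are linear functions (and are identified with nonnegative real numbers $\gamma_{ij}$), the linear operator $\Gamma_\boxplus:\ell_\infty(I)\to\ell_\infty(I)$, $\Gamma_\boxplus(s):=(\sum_{j\in I}\gamma_{ij}s_j)_{i\in I}$, is well-defined (thus bounded) and its spectral radius satisfies $r(\Gamma_\boxplus)<1$. Then $\Sigma$ is ISS.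
   Context: **Comparison functions.** $\mathcal{K}$: continuous strictly increasing $\gamma:\mathbb{R}_+\to\mathbb{R}_+$ with $\gamma(0)=0$. $\mathcal{L}$: continuous strictly decreasing $\gamma:\mathbb{R}_+\to\mathbb{R}_+$ with $\gamma(t)\to0$ as $t\to\infty$. $\mathcal{KL}$: continuous $\beta:\mathbb{R}_+^2\to\mathbb{R}_+$ with $\beta(\cdot,t)\in\mathcal{K}$ for all $t\ge0$ and $\beta(r,\cdot)\in\mathcal{L}$ for all $r>0$. In $\mathcal{K}\cup\{0\}$, $0$ is the zero function. **Sequence spaces.** $\ell_\infty(I)$ is the Banach space of bounded functions $x:I\to\mathbb{R}$ with the sup-norm. $\Gamma_\boxplus$ is well-defined if and only if $\sup_{i\in I}\sum_{j\in I}\gamma_{ij}(r)<\infty$ for every $r>0$. For $w:J\to W$ bounded, $J\subset\mathbb{R}_+$ nonempty, $W$ normed, $\|w\|_J:=\sup_{s\in J}\|w(s)\|_W$. The spectral radius is $r(\Gamma_\boxplus)=\lim_{n\to\infty}\|\Gamma_\boxplus^n\|^{1/n}$ (operator norm on $\ell_\infty(I)$). **Control systems.** A control system is a triple $\Sigma=(X,\mathcal{U},\phi)$ with: a normed space $(X,\|\cdot\|_X)$ (state space); a vector space $U$ of input values and a normed space of inputs $(\mathcal{U},\|\cdot\|_{\mathcal{U}})$, $\mathcal{U}$ a linear subspace of $U^{\mathbb{R}_+}$ (all maps $\mathbb{R}_+\to U$), satisfying shift invariance (for all $u\in\mathcal{U}$, $\tau\ge0$: $u(\cdot+\tau)\in\mathcal{U}$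 and $\|u\|_{\mathcal{U}}\ge\|u(\cdot+\tau)\|_{\mathcal{U}}$) and concatenation (for all $u_1,u_2\in\mathcal{U}$, $t>0$, the function equal to $u_1(\tau)$ for $\tau\in[0,t]$ and $u_2(\tau-t)$ for $\tau>t$ is in $\mathcal{U}$); a transition map $\phi:D_\phi\to X$, $D_\phi\subseteq\mathbb{R}_+\times X\times\mathcal{U}$, such that for all $(x,u)$ one has $D_\phi\cap(\mathbb{R}_+\times\{(x,u)\})=[0,t_m)\times\{(x,u)\}$ for some $t_m=t_m(x,u)\in(0,\infty]$. The following axioms are required: $\phi(0,x,u)=x$; causality (if $(t,x,u)\in D_\phi$ and $\tilde u\in\mathcal{U}$ agrees with $u$ on $[0,t]$, then $[0,t]\times\{(x,\tilde u)\}\subset D_\phi$ and $\phi(t,x,u)=\phi(t,x,\tilde u)$); continuity of $t\mapsto\phi(t,x,u)$ on $[0,t_m(x,u))$; cocycle property (if $[0,t+h]\times\{(x,u)\}\subset D_\phi$, $t,h\ge 0$, then $\phi(h,\phi(t,x,u),u(t+\cdot))=\phi(t+h,x,u)$). $\Sigma$ is forward complete if $D_\phi=\mathbb{R}_+\times X\times\mathcal{U}$. $\Sigma$ has the boundedness-implies-continuation (BIC) property if for each $(x,u)$ with $t_m(x,u)<\infty$ and each $M>0$ there is $t\in[0,t_m)$ with $\|\phi(t,x,u)\|_X>M$. **ISS.** $\Sigma$ is input-to-state stable (ISS) if there are $\beta\in\mathcal{KL}$, $\gamma\in\mathcal{K}\cup\{0\}$ with $\|\phi(t,x,u)\|_X\le\beta(\|x\|_X,t)+\gamma(\|u\|_{\mathcal{U}})$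 for all $(t,x,u)\in D_\phi$. **Interconnections.** Given normed spaces $X_i$, $i\in I$, put $X:=\{(x_i)_{i\in I}\in\prod_i X_i:\sup_i\|x_i\|_{X_i}<\infty\}$ with $\|x\|_X:=\sup_i\|x_i\|_{X_i}$, and let $X_{\neq i}$ be the same construction for the index set $I\setminus\{i\}$. $\mathrm{PC}_b(\mathbb{R}_+,X_{\neq i})$ is the space of globally bounded piecewise continuous functions $w:\mathbb{R}_+\to X_{\neq i}$ with sup-norm $\|w\|_\infty$. $\mathcal{U}$ is a fixed normed space of inputs (satisfying shift invariance and concatenation), common to all subsystems, and $\mathrm{PC}_b(\mathbb{R}_+,X_{\neq i})\times\mathcal{U}$ has norm $\max\{\|w\|_\infty,\|u\|_{\mathcal{U}}\}$. Given control systems $\Sigma_i=(X_i,\mathrm{PC}_b(\mathbb{R}_+,X_{\neq i})\times\mathcal{U},\bar\phi_i)$, consider maps $\phi:D_\phi\to X$, $D_\phi\subset\mathbb{R}_+\times X\times\mathcal{U}$, such that (1) for each $(x,u)\in X\times\mathcal{U}$ there is $\varepsilon>0$ with $[0,\varepsilon]\times\{(x,u)\}\subset D_\phi$; (2) the components satisfy $\phi_i(t,x,u)=\bar\phi_i(t,x_i,(\phi_{\neq i},u))$ for all $(t,x,u)\in D_\phi$, $i\in I$, where $\phi_{\neq i}(\cdot)=(\phi_j(\cdot,x,u))_{j\in I\setminus\{i\}}$ (by causality only the values of $\phi_{\neq i}$ on $[0,t]$ matter, so it can be regarded as globally bounded); and $\phi$ is maximal, i.e. no proper extension of $\phi$ satisfies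 these properties. If the map $\phi$ with these properties is unique and $\Sigma=(X,\mathcal{U},\phi)$ is a control system satisfying the BIC property, then $\Sigma$ is called the (well-defined) interconnection of the $\Sigma_i$. **ISS of $\Sigma_i$ in summation formulation.** $\Sigma_i$ is forward complete and there are $\beta_i\in\mathcal{KL}$ and $\gamma_{ij},\gamma_i\in\mathcal{K}\cup\{0\}$ ($j\in I$) such that for all $x_i\in X_i$, $w_{\neq i}=(w_j)_{j\in I\setminus\{i\}}\in\mathrm{PC}_b(\mathbb{R}_+,X_{\neq i})$, $u\in\mathcal{U}$, $t\ge0$: $\|\bar\phi_i(t,x_i,(w_{\neq i},u))\|_{X_i}\le\beta_i(\|x_i\|_{X_i},t)+\sum_{j\in I}\gamma_{ij}(\|w_j\|_{[0,t]})+\gamma_i(\|u\|_{\mathcal{U}})$, where $\sum_{j\in I}\gamma_{ij}(r)<\infty$ for every $r\ge0$ and $\gamma_{ii}=0$ (so the term $j=i$ is $0$). *)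

(* Defs.v *)
From HB Require Import structures.
From mathcomp Require Import all_boot all_order all_algebra.
From mathcomp Require Import all_classical all_reals all_analysis.

Set Implicit Arguments.
Unset Strict Implicit.
Unset Printing Implicit Defensive.

Import Order.TTheory GRing.Theory Num.Theory.
Import numFieldNormedType.Exports.

Local Open Scope classical_set_scope.
Local Open Scope ring_scope.

(* Comparison functions are functions on R of which only the restriction to
   [0, +oo[ is relevant; nonnegativity on [0, +oo[ is implied. *)
Section comparison_functions.
Variable R : realType.
Implicit Types (gamma : R -> R) (beta : R -> R -> R).

Definition class_K gamma : Prop :=
  [/\ {within `[0, +oo[, continuous gamma},
      gamma 0 = 0 &
      {in `[0, +oo[ &, {homo gamma : r s / r < s}}].

Definition class_K0 gamma : Prop :=
  class_K gamma \/ forall r : R, 0 <= r -> gamma r = 0.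

Definition class_L gamma : Prop :=
  [/\ {within `[0, +oo[, continuous gamma},
      {in `[0, +oo[ &, {homo gamma : r s / r < s >-> s < r}} &
      gamma r @[r --> +oo] --> 0].

Definition class_KL beta : Prop :=
  [/\ {within (`[0, +oo[ `*` `[0, +oo[ : set (R * R)),
        continuous (fun p : R * R => beta p.1 p.2)},
      forall t : R, 0 <= t -> class_K (beta ^~ t) &
      forall r : R, 0 < r -> class_L (beta r)].

End comparison_functions.

(* The normed space of bounded families (x_i)_i of the product of the X_i,
   with the supremum norm. *)
Section bounded_families.
Variables (R : realType) (I : Type) (X : I -> normedModType R).

Record bfam := BFam {
  bf_fun :> forall i, X i;
  bf_bounded : exists M, forall i, `|bf_fun i| <= M }.

HB.instance Definition _ := gen_eqMixin bfam.
HB.instance Definition _ := gen_choiceMixin bfam.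

Lemma bfamP (x y : bfam) : (forall i, x i = y i) -> x = y.
Proof.
case: x y => [x hx] [y hy] /= xy.
have e : x = y by apply: functional_extensionality_dep.
by subst y; congr BFam; exact: Prop_irrelevance.
Qed.

Lemma bf_zero_bounded : exists M : R, forall i, `|0 : X i| <= M.
Proof. by exists 0 => i; rewrite normr0. Qed.

Lemma bf_opp_bounded (x : bfam) : exists M : R, forall i, `|- x i| <= M.
Proof. by have [M h] := bf_bounded x; exists M => i; rewrite normrN. Qed.

Lemma bf_add_bounded (x y : bfam) : exists M : R, forall i, `|x i + y i| <= M.
Proof.
have [M h] := bf_bounded x; have [N k] := bf_bounded y; exists (M + N) => i.
by rewrite (le_trans (ler_normD _ _))// lerD.
Qed.

Lemma bf_scale_bounded (a : R) (x : bfam) :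
  exists M : R, forall i, `|a *: x i| <= M.
Proof.
have [M h] := bf_bounded x; exists (`|a| * M) => i.
by rewrite normrZ ler_wpM2l ?h.
Qed.

Definition bf_zero := BFam bf_zero_bounded.
Definition bf_opp x := BFam (bf_opp_bounded x).
Definition bf_add x y := BFam (bf_add_bounded x y).
Definition bf_scale a x := BFam (bf_scale_bounded a x).

Fact bf_addA : associative bf_add.
Proof. by move=> x y z; apply: bfamP => i /=; rewrite addrA. Qed.
Fact bf_addC : commutative bf_add.
Proof. by move=> x y; apply: bfamP => i /=; rewrite addrC. Qed.
Fact bf_add0 : left_id bf_zero bf_add.
Proof. by move=> x; apply: bfamP => i /=; rewrite add0r. Qed.
Fact bf_addN : left_inverse bf_zero bf_opp bf_add.
Proof. by move=> x; apply: bfamP => i /=; rewrite addNr. Qed.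

HB.instance Definition _ :=
  GRing.isZmodule.Build bfam bf_addA bf_addC bf_add0 bf_addN.

Fact bf_scaleA a b x : bf_scale a (bf_scale b x) = bf_scale (a * b) x.
Proof. by apply: bfamP => i /=; rewrite scalerA. Qed.
Fact bf_scale1 : left_id 1 bf_scale.
Proof. by move=> x; apply: bfamP => i /=; rewrite scale1r. Qed.
Fact bf_scaleDr : right_distributive bf_scale +%R.
Proof. by move=> a x y; apply: bfamP => i /=; rewrite scalerDr. Qed.
Fact bf_scaleDl x : {morph bf_scale^~ x : a b / a + b}.
Proof. by move=> a b; apply: bfamP => i /=; rewrite scalerDl. Qed.

HB.instance Definition _ := GRing.Zmodule_isLmodule.Build R bfam
  bf_scaleA bf_scale1 bf_scaleDr bf_scaleDl.

(* For an empty index set this is sup set0 = 0. *)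
Definition bf_norm (x : bfam) : R := sup (range (fun i => `|x i|)).

Lemma bf_norm_ub (x : bfam) i : `|x i| <= bf_norm x.
Proof.
have [M h] := bf_bounded x.
by apply: ub_le_sup; [exists M => _ [j _ <-] | exists i].
Qed.

Lemma bf_norm_ge0 (x : bfam) : 0 <= bf_norm x.
Proof.
rewrite /bf_norm.
have [->|/set0P[_ [i _ _]]] := eqVneq (range (fun i => `|x i|)) set0.
  by rewrite sup0.
exact: le_trans (bf_norm_ub x i).
Qed.

Lemma bf_norm_le (x : bfam) (M : R) :
  0 <= M -> (forall i, `|x i| <= M) -> bf_norm x <= M.
Proof.
move=> M0 h; rewrite /bf_norm.
have [->|/set0P ne] := eqVneq (range (fun i => `|x i|)) set0.
  by rewrite sup0.
by apply: ge_sup => // _ [i _ <-].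
Qed.

Fact bf_normD x y : bf_norm (x + y) <= bf_norm x + bf_norm y.
Proof.
apply: bf_norm_le => [|i]; first by rewrite addr_ge0 ?bf_norm_ge0.
by rewrite (le_trans (ler_normD _ _))// lerD// bf_norm_ub.
Qed.

Fact bf_normZ (a : R) x : bf_norm (a *: x) = `|a| * bf_norm x.
Proof.
have le b y : bf_norm (b *: y) <= `|b| * bf_norm y.
  apply: bf_norm_le => [|i]; first by rewrite mulr_ge0 ?bf_norm_ge0.
  by rewrite normrZ ler_wpM2l// bf_norm_ub.
apply/eqP; rewrite eq_le le /=.
have [->|a0] := eqVneq a 0; first by rewrite normr0 mul0r bf_norm_ge0.
have := le a^-1 (a *: x); rewrite scalerA mulVf// scale1r normfV.
by rewrite mulrC ler_pdivlMr ?normr_gt0// mulrC.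
Qed.

Fact bf_norm_eq0 x : bf_norm x = 0 -> x = 0.
Proof.
move=> x0; apply: bfamP => i /=; apply/eqP.
by rewrite -normr_le0 -x0 bf_norm_ub.
Qed.

HB.instance Definition _ :=
  Lmodule_isNormed.Build R bfam bf_normD bf_normZ bf_norm_eq0.

End bounded_families.

(* Functions on R_+ have domain {nonneg R}; [half_line w] extends w to R by
   its value at 0, so that continuity of w at t >= 0 relative to R_+ is
   ordinary continuity of [half_line w] at t. *)
Fact nnpart_ge0 (R : realType) (x : R) : 0 <= Num.max x 0.
Proof. by rewrite le_max lexx orbT. Qed.

Definition nnpart (R : realType) (x : R) : {nonneg R} := NngNum (nnpart_ge0 x).

Definition half_line (R : realType) (T : Type) (w : {nonneg R} -> T) (x : R) : T :=
  w (nnpart x).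

Definition shift_fun (R : realType) (T : Type) (tau : {nonneg R})
    (w : {nonneg R} -> T) (t : {nonneg R}) : T :=
  w (t%:num + tau%:num)%:nng.

Definition concat_fun (R : realType) (T : Type) (t : {nonneg R})
    (w1 w2 : {nonneg R} -> T) (s : {nonneg R}) : T :=
  if s%:num <= t%:num then w1 s else w2 (nnpart (s%:num - t%:num)).

(* Finitely many discontinuities on every bounded interval, and one-sided
   limits everywhere. *)
Definition piecewise_continuous (R : realType) (W : normedModType R)
    (w : {nonneg R} -> W) : Prop :=
  [/\ forall T : R, finite_set
        [set t : R | 0 <= t <= T /\ ~ {for t, continuous (half_line w)}],
      forall t : R, 0 <= t -> cvg (half_line w x @[x --> t^'+]) &
      forall t : R, 0 < t -> cvg (half_line w x @[x --> t^'-])].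

Section piecewise_continuous_functions.
Variables (R : realType) (W : normedModType R).
Implicit Types (w v : {nonneg R} -> W).

Lemma nnpart_num (t : {nonneg R}) : nnpart t%:num = t.
Proof. by apply/val_inj => /=; rewrite max_l. Qed.

Lemma nnpartE (x : R) : 0 <= x -> (nnpart x)%:num = x.
Proof. by move=> x0 /=; rewrite max_l. Qed.

Lemma pc_linear (a : R) w v : piecewise_continuous w ->
  piecewise_continuous v -> piecewise_continuous (fun t => a *: w t + v t).
Proof.
move=> [w1 w2 w3] [v1 v2 v3]; split=> [T|t t0|t t0].
- apply: sub_finite_set (_ : finite_set (_ `|` _)); last first.
    by rewrite finite_setU; split; [exact: (w1 T) | exact: (v1 T)].
  move=> t /= [tT nc]; apply: contrapT => /not_orP[].
  move=> /not_andP[//|/contrapT cw] /not_andP[//|/contrapT cv].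
  by apply: nc; apply: cvgD => //; apply: cvgZr.
- by apply: is_cvgD; [apply: is_cvgZr; exact: w2 | exact: v2].
- by apply: is_cvgD; [apply: is_cvgZr; exact: w3 | exact: v3].
Qed.

Lemma half_line_shift (tau : {nonneg R}) w (x : R) : 0 <= x ->
  half_line (shift_fun tau w) x = half_line w (x + tau%:num).
Proof.
move=> x0; rewrite /half_line /shift_fun; congr w; apply/val_inj => /=.
by rewrite !max_l// addr_ge0.
Qed.

Lemma near_translate (P : R -> Prop) (t u : R) :
  (\forall y \near t + u, P y) -> \forall x \near t, P (x + u).
Proof.
have : (x + u) @[x --> t] --> t + u by apply: cvgD => //; exact: cvg_cst.
by apply.
Qed.

Lemma cvg_right_shift (t u : R) : (x + u) @[x --> t^'+] --> (t + u)^'+.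
Proof.
move=> P /= /(@near_translate (fun y => t + u < y -> P y)) h.
by apply: filterS h => x /= hx tx; apply: hx; rewrite ltrD2r.
Qed.

Lemma cvg_left_shift (t u : R) : (x + u) @[x --> t^'-] --> (t + u)^'-.
Proof.
move=> P /= /(@near_translate (fun y => y < t + u -> P y)) h.
by apply: filterS h => x /= hx tx; apply: hx; rewrite ltrD2r.
Qed.

Lemma pc_shift tau w :
  piecewise_continuous w -> piecewise_continuous (shift_fun tau w).
Proof.
move=> [w1 w2 w3]; split=> [T|t t0|t t0].
- have := finite_image (fun x : R => x - tau%:num) (w1 (T + tau%:num)).
  apply: sub_finite_set => t /= [/andP[t0 tT] nc]; exists (t + tau%:num).
    split; first by rewrite addr_ge0//= lerD2r.
    move=> c; apply: nc.
    have c' : half_line w (x + tau%:num) @[x --> t] --> half_line w (t + tau%:num).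
      apply: continuous_comp; last exact: c.
      by apply: cvgD => //; exact: cvg_cst.
    rewrite /prop_for /continuous_at half_line_shift//.
    move: t0; rewrite le_eqVlt => /predU1P[t0|t0]; last first.
      apply: cvg_trans c'; apply: near_eq_cvg; near=> x.
      by rewrite half_line_shift//; apply: ltW; near: x; exact: lt_nbhsr.
    rewrite -t0 add0r in c' *.
    move/cvgrPdist_lt: c' => c'; apply/cvgrPdist_lt => e e0.
    near=> x; have [x0|x0] := leP 0 x.
      by rewrite half_line_shift//; near: x; apply: c'.
    rewrite [half_line (shift_fun _ _) _](_ : _ = half_line w tau%:num).
      by rewrite subrr normr0.
    rewrite /half_line /shift_fun; congr w; apply/val_inj => /=.
    by rewrite (max_r (ltW x0)) add0r max_l.
  by rewrite addrK.
- have /cvg_ex[l wl] := w2 (t + tau%:num) ltac:(by rewrite addr_ge0).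
  apply/cvg_ex; exists l.
  apply: cvg_trans (cvg_comp _ _ (@cvg_right_shift t tau%:num) wl).
  apply: near_eq_cvg; near=> x; rewrite half_line_shift//.
  by apply: (le_trans t0); apply: ltW; near: x; exact: nbhs_right_gt.
- have /cvg_ex[l wl] := w3 (t + tau%:num) ltac:(by rewrite ltr_wpDr).
  apply/cvg_ex; exists l.
  apply: cvg_trans (cvg_comp _ _ (@cvg_left_shift t tau%:num) wl).
  apply: near_eq_cvg; near=> x; rewrite half_line_shift//.
  by near: x; exact: nbhs_left_ge.
Unshelve. all: by end_near. Qed.

Lemma concat_left t w v (x : R) : x <= t%:num ->
  half_line (concat_fun t w v) x = half_line w x.
Proof.
move=> xt; rewrite /half_line /concat_fun ifT//=.
by rewrite ge_max xt /=.
Qed.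

Lemma concat_right t w v (x : R) : t%:num < x ->
  half_line (concat_fun t w v) x = half_line v (x - t%:num).
Proof.
move=> tx; have x0 : 0 <= x by rewrite (le_trans _ (ltW tx)).
by rewrite /half_line /concat_fun /= max_l// leNgt tx.
Qed.

Lemma pc_concat t w v : piecewise_continuous w ->
  piecewise_continuous v -> piecewise_continuous (concat_fun t w v).
Proof.
move=> [w1 w2 w3] [v1 v2 v3]; split=> [T|s s0|s s0].
- have fv := finite_image (fun x : R => x + t%:num) (v1 T).
  apply: sub_finite_set (_ : finite_set
     (_ `|` [set t%:num] `|` (fun x : R => x + t%:num) @` _)); last first.
    by rewrite !finite_setU; split; [split; [exact: (w1 T)|] | exact: fv].
  move=> s /= [/andP[s0 sT] nc].
  have [st|ts|->] := ltgtP s t%:num; last by left; right.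
    left; left; split; first by rewrite s0.
    move=> c; apply: nc; rewrite /prop_for /continuous_at concat_left ?ltW//.
    apply: cvg_trans c; apply: near_eq_cvg; near=> x.
    by rewrite concat_left//; apply: ltW; near: x; exact: lt_nbhsl.
  right; exists (s - t%:num); last by rewrite subrK.
  split; first by rewrite subr_ge0 (ltW ts)/= (le_trans _ sT)// gerBl.
  move=> c; apply: nc; rewrite /prop_for /continuous_at concat_right//.
  have c' : half_line v (x - t%:num) @[x --> s] --> half_line v (s - t%:num).
    apply: continuous_comp; last exact: c.
    by apply: cvgB => //; exact: cvg_cst.
  apply: cvg_trans c'; apply: near_eq_cvg; near=> x.
  by rewrite concat_right//; near: x; exact: lt_nbhsr.
- have [st|ts] := ltP s t%:num.
    have /cvg_ex[l wl] := w2 s s0.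
    apply/cvg_ex; exists l; apply: cvg_trans wl.
    apply: near_eq_cvg; near=> x; rewrite concat_left//.
    by near: x; exact: nbhs_right_le.
  have /cvg_ex[l vl] := v2 (s - t%:num) ltac:(by rewrite subr_ge0).
  apply/cvg_ex; exists l.
  apply: cvg_trans (cvg_comp _ _ (@cvg_right_shift s (- t%:num)) vl).
  apply: near_eq_cvg; near=> x; rewrite concat_right//.
  by apply: (le_lt_trans ts); near: x; exact: nbhs_right_gt.
- have [st|ts] := leP s t%:num.
    have /cvg_ex[l wl] := w3 s s0.
    apply/cvg_ex; exists l; apply: cvg_trans wl.
    apply: near_eq_cvg; near=> x; rewrite concat_left//.
    by apply: (le_trans _ st); near: x; exact: nbhs_left_le.
  have /cvg_ex[l vl] := v3 (s - t%:num) ltac:(by rewrite subr_gt0).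
  apply/cvg_ex; exists l.
  apply: cvg_trans (cvg_comp _ _ (@cvg_left_shift s (- t%:num)) vl).
  apply: near_eq_cvg; near=> x; rewrite concat_right//.
Unshelve. all: by end_near. Qed.

Lemma pc_cst (c : W) : piecewise_continuous (fun=> c).
Proof.
split=> [T|t _|t _]; try exact: is_cvg_cst.
rewrite (_ : [set _ | _] = set0)//; apply/seteqP; split=> // t [_]; apply.
exact: cvg_cst.
Qed.

End piecewise_continuous_functions.

(* PC_b(R_+, W) *)
Section bounded_piecewise_continuous.
Variables (R : realType) (W : normedModType R).

Definition pcb_pred : {pred bfam (fun _ : {nonneg R} => W)} :=
  fun w => `[< piecewise_continuous (w : {nonneg R} -> W) >].

Fact pcb_submod : submod_closed pcb_pred.
Proof.
split=> [|a w v /asboolP hw /asboolP hv]; apply/asboolP.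
  exact: (@pc_cst R W 0).
exact: (pc_linear a hw hv).
Qed.

HB.instance Definition _ :=
  GRing.isSubmodClosed.Build R (bfam (fun _ : {nonneg R} => W)) pcb_pred
    pcb_submod.

Record pcb := Pcb {
  pcb_val :> bfam (fun _ : {nonneg R} => W);
  pcb_valP : pcb_val \in pcb_pred }.

HB.instance Definition _ := [isSub for pcb_val].
HB.instance Definition _ := [Choice of pcb by <:].
HB.instance Definition _ := [SubChoice_isSubLmodule of pcb by <:].

Definition pcb_norm (w : pcb) : R := `|pcb_val w|.

Fact pcb_normD w v : pcb_norm (w + v) <= pcb_norm w + pcb_norm v.
Proof. exact: ler_normD. Qed.
Fact pcb_normZ (a : R) w : pcb_norm (a *: w) = `|a| * pcb_norm w.
Proof. exact: normrZ. Qed.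
Fact pcb_norm_eq0 w : pcb_norm w = 0 -> w = 0.
Proof. by move=> /normr0_eq0 w0; apply/val_inj. Qed.

HB.instance Definition _ :=
  Lmodule_isNormed.Build R pcb pcb_normD pcb_normZ pcb_norm_eq0.

Fact pcb_shift_bounded (tau : {nonneg R}) (w : pcb) :
  exists M, forall t, `|shift_fun tau w t| <= M.
Proof. by have [M h] := bf_bounded w; exists M => t; exact: h. Qed.

Fact pcb_shiftP tau w : BFam (pcb_shift_bounded tau w) \in pcb_pred.
Proof. by apply/asboolP/pc_shift/asboolP; exact: pcb_valP. Qed.

Definition pcb_shift tau w : pcb := Pcb (pcb_shiftP tau w).

Fact pcb_concat_bounded (t : {nonneg R}) (w v : pcb) :
  exists M, forall s, `|concat_fun t w v s| <= M.
Proof.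
have [M h] := bf_bounded w; have [N k] := bf_bounded v.
exists (Num.max M N) => s; rewrite /concat_fun le_max.
by case: ifP => _; rewrite ?h ?k ?orbT.
Qed.

Fact pcb_concatP t w v : BFam (pcb_concat_bounded t w v) \in pcb_pred.
Proof. by apply/asboolP/pc_concat; apply/asboolP; exact: pcb_valP. Qed.

Definition pcb_concat t w v : pcb := Pcb (pcb_concatP t w v).

Lemma pcb_shift_norm tau w : `|pcb_shift tau w| <= `|w|.
Proof.
apply: (@bf_norm_le _ _ _ (pcb_val (pcb_shift tau w))).
  exact: bf_norm_ge0.
by move=> t; exact: (bf_norm_ub (pcb_val w)).
Qed.

End bounded_piecewise_continuous.

(* A normed space of inputs: a normed space realized, through the injective
   linear map [inp_fun], as a space of functions R_+ -> U that is closed under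
   shifts and concatenations. *)
Record input_space (R : realType) (U : lmodType R) := InputSpace {
  inp :> normedModType R;
  inp_fun : inp -> {nonneg R} -> U;
  inp_fun_linear : forall (a : R) (u v : inp) t,
    inp_fun (a *: u + v) t = a *: inp_fun u t + inp_fun v t;
  inp_fun_inj : injective inp_fun;
  inp_shift : {nonneg R} -> inp -> inp;
  inp_shiftE : forall tau u, inp_fun (inp_shift tau u) = shift_fun tau (inp_fun u);
  inp_shift_norm : forall tau u, `|inp_shift tau u| <= `|u|;
  inp_concat : {nonneg R} -> inp -> inp -> inp;
  inp_concatE : forall (t : {nonneg R}) u v, 0 < t%:num ->
    inp_fun (inp_concat t u v) = concat_fun t (inp_fun u) (inp_fun v) }.

(* PC_b(R_+, W) x UU, as a space of functions R_+ -> W * U; the library norm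
   on a product is the maximum norm. *)
Section product_input_space.
Variables (R : realType) (W : normedModType R) (U : lmodType R).
Variable UU : input_space U.

Definition prod_inp : normedModType R := (pcb W * UU)%type.

Definition prod_inp_fun (p : prod_inp) (t : {nonneg R}) : W * U :=
  (p.1 t, inp_fun p.2 t).
Definition prod_inp_shift tau (p : prod_inp) : prod_inp :=
  (pcb_shift tau p.1, inp_shift tau p.2).
Definition prod_inp_concat t (p q : prod_inp) : prod_inp :=
  (pcb_concat t p.1 q.1, inp_concat t p.2 q.2).

Fact prod_inp_linear (a : R) (p q : prod_inp) t :
  prod_inp_fun (a *: p + q) t = a *: prod_inp_fun p t + prod_inp_fun q t.
Proof. by rewrite /prod_inp_fun /= inp_fun_linear. Qed.

Fact prod_inp_inj : injective prod_inp_fun.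
Proof.
move=> [w u] [v u'] e; congr pair.
  by apply/val_inj/bfamP => t; have [] := congr1 (@^~ t) e.
by apply: (@inp_fun_inj _ _ UU); apply/funext => t; have [] := congr1 (@^~ t) e.
Qed.

Fact prod_inp_shiftE tau p :
  prod_inp_fun (prod_inp_shift tau p) = shift_fun tau (prod_inp_fun p).
Proof. by apply/funext => t; rewrite /prod_inp_fun/= inp_shiftE. Qed.

Fact prod_inp_shift_norm tau p : `|prod_inp_shift tau p| <= `|p|.
Proof.
rewrite !prod_normE/= ge_max !le_max.
by rewrite pcb_shift_norm /= inp_shift_norm orbT.
Qed.

Fact prod_inp_concatE (t : {nonneg R}) p q : 0 < t%:num ->
  prod_inp_fun (prod_inp_concat t p q) =
  concat_fun t (prod_inp_fun p) (prod_inp_fun q).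
Proof.
move=> t0; apply/funext => s; rewrite /prod_inp_fun/= inp_concatE//.
by rewrite /concat_fun; case: ifP.
Qed.

Definition prod_input_space : input_space (W * U)%type :=
  InputSpace prod_inp_linear prod_inp_inj prod_inp_shiftE prod_inp_shift_norm
    prod_inp_concatE.

End product_input_space.

Section control_systems.
Variables (R : realType) (X : normedModType R) (U : lmodType R).
Variable UU : input_space U.

(* The partial map phi with domain {(t, x, u) | t < tmax x u}; the values of
   [flow] outside of this domain are irrelevant. *)
Record control_system := ControlSystem {
  tmax : X -> UU -> \bar R;
  flow : {nonneg R} -> X -> UU -> X;
  tmax_gt0 : forall x u, (0 < tmax x u)%E;
  flow0 : forall x u, flow 0%:nng x u = x;
  flow_causal : forall (t : {nonneg R}) x u v, (t%:num%:E < tmax x u)%E ->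
    (forall s : {nonneg R}, s%:num <= t%:num -> inp_fun u s = inp_fun v s) ->
    (t%:num%:E < tmax x v)%E /\ flow t x u = flow t x v;
  flow_continuous : forall x u,
    {within [set t : R | 0 <= t /\ (t%:E < tmax x u)%E],
      continuous (half_line (fun t => flow t x u))};
  flow_cocycle : forall (t h : {nonneg R}) x u,
    ((t%:num + h%:num)%:E < tmax x u)%E ->
    (h%:num%:E < tmax (flow t x u) (inp_shift t u))%E /\
    flow h (flow t x u) (inp_shift t u) = flow (t%:num + h%:num)%:nng x u }.

Definition flow_dom (S : control_system) (t : {nonneg R}) x u : Prop :=
  (t%:num%:E < tmax S x u)%E.

Definition forward_complete (S : control_system) : Prop :=
  forall t x u, flow_dom S t x u.

Definition BIC (S : control_system) : Prop :=
  forall x u, (tmax S x u < +oo)%E -> forall M : R, 0 < M ->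
    exists2 t, flow_dom S t x u & M < `|flow S t x u|.

Definition ISS (S : control_system) : Prop :=
  exists beta gamma, [/\ class_KL beta, class_K0 gamma &
    forall t x u, flow_dom S t x u ->
      `|flow S t x u| <= beta `|x| t%:num + gamma `|u|].

End control_systems.

Section partial_flows.
Variables (R : realType) (X Y : Type).

Record partial_flow := PartialFlow {
  pf_dom : {nonneg R} -> X -> Y -> Prop;
  pf_val : {nonneg R} -> X -> Y -> X }.

Definition pf_extends (p q : partial_flow) : Prop :=
  forall t x u, pf_dom q t x u ->
    pf_dom p t x u /\ pf_val p t x u = pf_val q t x u.

Definition pf_eq (p q : partial_flow) : Prop :=
  pf_extends p q /\ pf_extends q p.

End partial_flows.

Section interconnections.
Variables (R : realType) (I : countType) (X : I -> normedModType R).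
Variables (U : lmodType R) (UU : input_space U).

Definition Xneq (i : I) : normedModType R :=
  bfam (fun j : {j : I | j != i} => X (val j)).

Fact bf_restr_bounded (i : I) (x : bfam X) :
  exists M : R, forall j : {j : I | j != i}, `|x (val j)| <= M.
Proof. by have [M h] := bf_bounded x; exists M => j; exact: h. Qed.

Definition bf_restr (i : I) (x : bfam X) : Xneq i :=
  BFam (bf_restr_bounded i x).

Definition subsystem (i : I) : Type :=
  control_system (X i) (prod_input_space (Xneq i) UU).

Variable Sigma : forall i, subsystem i.

(* In [phi_i(t,x,u) = phibar_i(t, x_i, (phi_{<>i}, u))], the function
   [phi_{<>i}(., x, u)] is replaced by a globally bounded piecewise continuous
   function that agrees with it on [0, t]; by causality the choice does not
   matter. *)
Definition solves (p : partial_flow R (bfam X) UU) : Prop :=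
  (forall x u, exists2 e : {nonneg R}, 0 < e%:num &
     forall t : {nonneg R}, t%:num <= e%:num -> pf_dom p t x u) /\
  (forall t x u i, pf_dom p t x u -> exists w : pcb (Xneq i),
     [/\ forall s : {nonneg R}, s%:num <= t%:num ->
           pf_dom p s x u /\ w s = bf_restr i (pf_val p s x u),
         flow_dom (Sigma i) t (x i) (w, u) &
         pf_val p t x u i = flow (Sigma i) t (x i) (w, u)]).

Definition maximal_solution (p : partial_flow R (bfam X) UU) : Prop :=
  solves p /\ forall q, solves q -> pf_extends q p -> pf_eq q p.

Definition pf_of (S : control_system (bfam X) UU) : partial_flow R (bfam X) UU :=
  PartialFlow (flow_dom S) (flow S).

Definition is_interconnection (S : control_system (bfam X) UU) : Prop :=
  [/\ maximal_solution (pf_of S),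
      forall q, maximal_solution q -> pf_eq q (pf_of S) &
      BIC S].

Definition comp_norm (i : I) (w : pcb (Xneq i)) (t : {nonneg R})
    (j : {j : I | j != i}) : R :=
  sup [set `|w s j| | s in [set s : {nonneg R} | s%:num <= t%:num]].

(* As gamma i = 0, the sum over all j reduces to a sum over j <> i. *)
Definition ISS_sum (i : I) (S : subsystem i) (beta : R -> R -> R)
    (gamma : I -> R -> R) (gammau : R -> R) : Prop :=
  [/\ forward_complete S,
      [/\ class_KL beta, forall j, class_K0 (gamma j) & class_K0 gammau],
      forall r : R, 0 <= r -> (\esum_(j in [set: I]) (gamma j r)%:E < +oo)%E,
      forall r : R, 0 <= r -> gamma i r = 0 &
      forall (x : X i) (w : pcb (Xneq i)) (u : UU) (t : {nonneg R}),
        (`|flow S t x (w, u)|%:E <= (beta `|x| t%:num)%:E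
          + \esum_(j in [set: {j : I | j != i}])
              (gamma (val j) (comp_norm w t j))%:E
          + (gammau `|u|)%:E)%E].

End interconnections.

Section gain_operators.
Variables (R : realType) (I : countType).

Definition linfty : normedModType R := bfam (fun _ : I => R^o : normedModType R).

(* T s = (\sum_j g i j * s j)_i, the (possibly signed) sums being absolutely
   convergent. *)
Definition is_gain_operator (g : I -> I -> R) (T : linfty -> linfty) : Prop :=
  forall (s : linfty) (i : I), let f j := (g i j * s j)%:E in
    summable [set: I] f /\
    (T s i : R)%:E =
      (\esum_(j in [set: I]) f^\+ j - \esum_(j in [set: I]) f^\- j)%E.

End gain_operators.

Definition operator_norm (R : realType) (V : normedModType R) (T : V -> V) : R :=
  sup [set `|T x| | x in [set x | `|x| <= 1]].

Definition spectral_radius (R : realType) (V : normedModType R) (T : V -> V) : R :=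
  limn (fun n => operator_norm (iter n T) `^ n%:R^-1).

(* Main.v *)
(* Some power of the gain operator maps the constant 1 to a vector of norm
   q < 1, by Fekete's lemma applied to ln |Gamma^n|, and
   eta = \sum_(k < n) Gamma^k 1 then satisfies 1 <= eta <= C and
   Gamma eta <= lambda eta with lambda < 1.  For the equivalent norm
   V x = sup_i |x_i| / eta_i the estimates of the subsystems collapse to the
   scalar one
     V(phi(t)) <= betamax(|x|, t) + lambda sup_[0, t] V(phi) + gammamax(|u|).
   Absorbing the supremum bounds V, so that Sigma is forward complete by BIC.
   Restarting the system at time t / 2 and iterating bounds V(phi(t)) by the
   KL function \sum_k lambda^k betamax(h(|x|), t / 2^(k+1)), up to a multiple
   of gammamax(|u|). *)
Require Import Defs.
From mathcomp Require Import all_boot all_order all_algebra.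
From mathcomp Require Import all_classical all_reals all_analysis.
From mathcomp Require Import ring lra.

Set Implicit Arguments.
Unset Strict Implicit.
Unset Printing Implicit Defensive.

Import Order.TTheory GRing.Theory Num.Theory.
Import numFieldNormedType.Exports.

Local Open Scope classical_set_scope.
Local Open Scope ring_scope.

(** * Fekete's lemma and the spectral radius condition *)

(** Euclidean division by an index [m.+1] whose quotient is within [e / 2] of the infimum gives
    [b n <= n%:R * (b m.+1 / m.+1%:R) + B] with [B] independent of [n], so that [B / n%:R] vanishes.
    The infimum avoids the index 0, where division by zero would contribute the value 0. *)
Lemma fekete (R : realType) (b : nat -> R) :
  (forall n, 0 <= b n) -> (forall m n, b (m + n)%N <= b m + b n) ->
  b n / n%:R @[n --> \oo] --> inf [set b n.+1 / n.+1%:R | n in setT].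
Proof.
move=> b0 bD; set A := (X in inf X); set L := inf A.
have Alb : lbound A 0 by move=> _ [n _ <-]; rewrite divr_ge0.
have hA : has_inf A by split; [exists (b 1%N / 1); exists 0%N | exists 0].
have Lle n : L <= b n.+1 / n.+1%:R.
  by apply: ge_inf; [exists 0 | exists n].
(* The summand [b 0] covers [q = 0], since subadditivity does not force it to vanish. *)
have bM q m : b (q * m)%N <= q%:R * b m + b 0%N.
  elim: q => [|q IH]; first by rewrite mul0n mul0r add0r.
  rewrite mulSn (le_trans (bD _ _))// (le_trans (lerD (lexx _) IH))//.
  by rewrite addrA -[X in X + _ * _]mul1r -mulrDl nat1r.
apply/cvgrPdist_lt => e e0.
have e20 : 0 < e / 2 by rewrite divr_gt0.
have [_ [m _ <-] hm] := inf_adherent e20 hA.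
rewrite -/L in hm; set B := b 0%N + \sum_(r < m.+1) b r.
have B0 : 0 <= B by rewrite addr_ge0 ?sumr_ge0.
have bB (n : nat) : b n <= n%:R * (b m.+1 / m.+1%:R) + B.
  rewrite {1}(divn_eq n m.+1) (le_trans (bD _ _))//.
  rewrite (le_trans (lerD (bM _ _) (lexx _)))// -addrA lerD//.
    rewrite mulrCA [leRHS]mulrC ler_wpM2r// ler_pdivlMr// -natrM ler_nat.
    exact: leq_divM.
  rewrite /B lerD2l (bigD1 (Ordinal (ltn_pmod n (ltn0Sn m))))//= lerDl.
  by rewrite sumr_ge0.
near=> n.
have n0 : (0 < n)%N by near: n; exists 1%N.
have nR : 0 < n%:R :> R by rewrite ltr0n.
have Bn : B / n%:R < e / 2.
  rewrite ltr_pdivrMr// mulrC -ltr_pdivrMr//; near: n; exact: nbhs_infty_gtr.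
rewrite ltr_norml; apply/andP; split; last first.
  rewrite ltrBlDr (le_lt_trans (Lle n.-1))// prednK// ltrDr//.
rewrite ltrBrDl ltrBlDr.
have : b n / n%:R <= b m.+1 / m.+1%:R + B / n%:R.
  rewrite ler_pdivrMr// mulrDl divfK ?gt_eqF// [_ * n%:R]mulrC; exact: bB.
move=> /le_lt_trans; apply; rewrite [e]splitr addrA.
exact: ltrD.
Unshelve. all: by end_near. Qed.

(* The hypothesis on [limn] alone would be void if the sequence diverged. *)
Lemma exists_lt1_of_root_limn_lt1 (R : realType) (a : nat -> R) :
  (forall m n, a (m + n)%N <= a m * a n) ->
  limn (fun n => a n `^ n%:R^-1) < 1 -> exists n, a n.+1 < 1.
Proof.
move=> aM lt1; apply: contrapT => /forallNP a1.
have a_ge1 n : 1 <= a n.+1 by rewrite leNgt; apply/negP/a1.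
have a0_ge1 : 1 <= a 0%N.
  have := aM 0%N 1%N; rewrite add0n -{1}[a 1%N]mul1r ler_pM2r//.
  exact: lt_le_trans ltr01 (a_ge1 _).
have ge1 n : 1 <= a n by case: n.
have gt0 n : 0 < a n by apply: lt_le_trans ltr01 (ge1 n).
have b0 n : 0 <= ln (a n) by rewrite ln_ge0.
have bD m n : ln (a (m + n)%N) <= ln (a m) + ln (a n).
  by rewrite -lnM ?posrE// ler_ln ?posrE ?mulr_gt0.
have := fekete b0 bD; set l := inf _ => cl.
have l0 : 0 <= l.
  apply: lb_le_inf; first by exists (ln (a 1%N) / 1); exists 0%N.
  by move=> _ [n _ <-]; rewrite divr_ge0.
(* The roots equal [expR (ln (a n) / n%:R)], so by Fekete's lemma they do converge, to
   [expR l >= 1]. *)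
move: lt1; rewrite -[X in X < 1](_ : expR l = _); first by rewrite ltNge -expR0 ler_expR l0.
apply/esym/cvg_lim => //.
rewrite (_ : (fun n => _) = (fun n => expR (ln (a n) / n%:R))).
  by apply: continuous_cvg cl; exact: continuous_expR.
by apply/funext => n; rewrite /powR gt_eqF// mulrC.
Qed.

(** * Nonnegative gain operators and their subeigenvectors *)

Lemma le_esumZ (R : realType) (T : choiceType) (c : R) (a : T -> R) :
  0 <= c -> (forall x, 0 <= a x) ->
  (\esum_(x in [set: T]) (c * a x)%:E <=
   c%:E * \esum_(x in [set: T]) (a x)%:E)%E.
Proof.
move=> c0 a0; apply: ge_ereal_sup => _ [A fA <-].
under eq_fsbigr do rewrite EFinM.
rewrite -ge0_mule_fsumr; last by move=> x; rewrite lee_fin.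
rewrite lee_wpmul2l ?lee_fin//; apply: esum_ge; exists A => //.
Qed.

Section gain_operator_theory.
Variables (R : realType) (I : countType) (g : I -> I -> R).
Variable T : linfty R I -> linfty R I.
Hypotheses (g_ge0 : forall i j, 0 <= g i j) (Tg : is_gain_operator g T).
Implicit Types (s : linfty R I) (i : I) (n : nat).

Lemma gain_operatorE s i : (forall j, 0 <= (s j : R)) ->
  (T s i : R)%:E = \esum_(j in [set: I]) (g i j * (s j : R))%:E.
Proof.
move=> s0; have [_ ->] := Tg s i.
have f0 j : ((0 : R)%:E <= (g i j * (s j : R))%:E)%E by rewrite lee_fin mulr_ge0.
rewrite [X in (_ - X)%E]esum1 ?sube0.
  by apply: eq_esum => j _; rewrite (ge0_funeposE (D := setT)) ?in_setT.
by move=> j _; rewrite (ge0_funenegE (D := setT)) ?in_setT.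
Qed.

(** The positive and negative parts of the signed sum add up to the sum of absolute values, which is
    compared termwise. Taking for [s'] the constant 1 and [c] equal to the norm of [s] reduces all
    operator norms to the orbit of 1. *)
Lemma gain_operator_dominated s s' (c : R) : 0 <= c ->
  (forall j, `|s j : R| <= c * (s' j : R)) -> (forall j, 0 <= (s' j : R)) ->
  forall i, `|T s i : R| <= c * (T s' i : R).
Proof.
move=> c0 ss' s'0 i; rewrite -lee_fin EFinM gain_operatorE//.
apply: le_trans (le_esumZ c0 _); last by move=> j; rewrite mulr_ge0.
have [_ e] := Tg s i; rewrite -abse_EFin {}e (le_trans (lee_abs_sub _ _))//.
rewrite !gee0_abs ?esum_ge0//; [|by move=> *; rewrite ?funeneg_ge0 ?funepos_ge0..].
rewrite -esumD//; try by move=> *; rewrite ?funeneg_ge0 ?funepos_ge0.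
apply: le_esum => j _.
have /= <- := congr1 (@^~ j) (fune_abse (fun j => (g i j * (s j : R))%:E)).
by rewrite lee_fin normrM ger0_norm// mulrCA ler_wpM2l.
Qed.

Lemma gain_operator_ge0 s i : (forall j, 0 <= (s j : R)) -> 0 <= (T s i : R).
Proof.
move=> s0; rewrite -lee_fin gain_operatorE// esum_ge0// => j _.
by rewrite lee_fin mulr_ge0.
Qed.

Lemma iter_gain_operator_ge0 s n i : (forall j, 0 <= (s j : R)) ->
  0 <= (iter n T s i : R).
Proof. by move=> s0; elim: n i => [|n IH] i //=; exact: gain_operator_ge0. Qed.

Lemma iter_gain_operator_dominated s s' (c : R) n : 0 <= c ->
  (forall j, `|s j : R| <= c * (s' j : R)) -> (forall j, 0 <= (s' j : R)) ->
  forall i, `|iter n T s i : R| <= c * (iter n T s' i : R).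
Proof.
move=> c0 ss' s'0; elim: n => [//|n IH] /=.
by apply: gain_operator_dominated => // j; exact: iter_gain_operator_ge0.
Qed.

Fact linfty1_bounded : exists M : R, forall i : I, `|(1 : R^o)| <= M.
Proof. by exists 1 => i; rewrite normr1. Qed.

Definition linfty1 : linfty R I := BFam linfty1_bounded.

Let v n : linfty R I := iter n T linfty1.

Let v_ge0 n i : 0 <= (v n i : R).
Proof. by apply: iter_gain_operator_ge0 => j; exact: ler01. Qed.

Let iter_le s n i : `|iter n T s i : R| <= `|s| * (v n i : R).
Proof.
apply: iter_gain_operator_dominated => // j.
by rewrite mulr1; exact: (bf_norm_ub s).
Qed.

(** The constant 1 dominates every element of the unit ball, so the supremum is attained there. *)
Lemma operator_norm_iter n : operator_norm (iter n T) = `|iter n T linfty1|.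
Proof.
have n1 : `|linfty1| <= 1.
  by apply: (bf_norm_le (x := linfty1)) => // i; rewrite normr1.
have ub s : `|s| <= 1 -> `|iter n T s| <= `|v n|.
  move=> s1; apply: (bf_norm_le (x := iter n T s)) => // i.
  rewrite (le_trans (iter_le _ _ _))//.
  rewrite (le_trans (ler_wpM2r (v_ge0 _ _) s1))// mul1r.
  by rewrite (le_trans (ler_norm _))//; exact: (bf_norm_ub (v n)).
apply/eqP; rewrite eq_le; apply/andP; split.
  by apply: ge_sup => [|_ [s /= /ub s1 <-]//]; exists `|v n|, linfty1.
apply: ub_le_sup; last by exists linfty1.
by exists `|v n| => _ [s /= /ub s1 <-].
Qed.

(** The vector [iter n T linfty1] is dominated by its norm times 1; applying [iter m T] gives the
    submultiplicativity that Fekete's lemma uses. *)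
Lemma operator_norm_iterD m n : operator_norm (iter (m + n) T) <=
  operator_norm (iter m T) * operator_norm (iter n T).
Proof.
rewrite !operator_norm_iter mulrC.
apply: (bf_norm_le (x := iter (m + n) T linfty1)) => [|i].
  by rewrite mulr_ge0.
rewrite iterD (le_trans (iter_le _ _ _))// ler_wpM2l//.
by rewrite (le_trans (ler_norm _))//; exact: (bf_norm_ub (v m)).
Qed.

(* If [|T^n 1| <= q < 1] then [eta = \sum_(k < n) T^k 1] satisfies
   [T eta = eta - 1 + T^n 1 <= eta - (1 - q)]. *)
Lemma spectral_radius_subeigenvector : spectral_radius T < 1 ->
  exists (eta : I -> R) (lambda C : R),
    [/\ 0 <= lambda < 1, 1 <= C, forall i, 1 <= eta i <= C &
      forall i, (\esum_(j in [set: I]) (g i j * eta j)%:E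
                   <= (lambda * eta i)%:E)%E].
Proof.
move=> /(exists_lt1_of_root_limn_lt1 operator_norm_iterD)[n].
rewrite operator_norm_iter -/(v n.+1) => q1; set q := `|v n.+1| in q1.
have q0 : 0 <= q by exact: normr_ge0.
pose eta i := \sum_(k < n.+1) (v k i : R).
(* The leading 1 gives [1 <= C] without choosing an index. *)
pose C := 1 + \sum_(k < n.+1) `|v k|.
have C1 : 1 <= C by rewrite lerDl sumr_ge0.
have C0 : 0 < C by exact: lt_le_trans C1.
have etaC i : eta i <= C.
  rewrite /eta /C -[leLHS]add0r lerD// ler_sum// => k _.
  by rewrite (le_trans (ler_norm _))//; exact: (bf_norm_ub (v k)).
have eta1 i : 1 <= eta i.
  by rewrite /eta big_ord_recl /= lerDl sumr_ge0// => k _; exact: (v_ge0 k.+1).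
(* As [eta i <= C], the constant decrease [1 - q] is at least the fraction [(1 - q) / C] of
   [eta i]. *)
exists eta, (1 - (1 - q) / C), C; split=> [||i|i] //.
- have d0 : 0 < (1 - q) / C by rewrite divr_gt0// subr_gt0.
  rewrite gtrBl d0 andbT subr_ge0 ler_pdivrMr// mul1r.
  by rewrite (le_trans _ C1)// gerBl.
- by rewrite eta1 etaC.
(* Exchanging the sums over [j] and [k] turns this into the orbit sum shifted by one index. *)
have -> : \esum_(j in [set: I]) (g i j * eta j)%:E =
    (\sum_(k < n.+1) (v k.+1 i : R))%:E.
  under eq_esum do rewrite mulr_sumr -sumEFin.
  rewrite esum_sum; last by move=> j k _ _; rewrite lee_fin mulr_ge0.
  by rewrite -sumEFin; apply: eq_bigr => k _; rewrite [RHS]gain_operatorE.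
rewrite lee_fin big_ord_recr /=.
have -> : \sum_(k < n) (v k.+1 i : R) = eta i - 1.
  by rewrite /eta big_ord_recl /= [1 + _]addrC addrK.
have vq : (v n.+1 i : R) <= q.
  by rewrite (le_trans (ler_norm _))//; exact: (bf_norm_ub (v n.+1)).
have : (1 - q) / C * eta i <= 1 - q.
  by rewrite mulrAC ler_pdivrMr// ler_wpM2l// subr_ge0 ltW.
by rewrite mulrBl mul1r; lra.
Qed.

End gain_operator_theory.

(** * Continuity relative to a subset *)

Lemma within_continuous_subset_comp (T V W : topologicalType) (A : set T)
    (B : set V) (f : T -> V) (h : V -> W) :
  {within A, continuous f} -> (forall x, A x -> B (f x)) ->
  {within B, continuous h} -> {within A, continuous (h \o f)}.
Proof.
move=> /subspace_continuousP cf AB /subspace_continuousP ch.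
apply/subspace_continuousP => x Ax.
apply: cvg_comp (ch _ (AB _ Ax)) => P /(cf _ Ax) /= hP.
have {}hP : \forall z \near x, A z -> B (f z) -> P (f z) := hP.
have : \forall z \near x, A z -> P (f z).
  by apply: filterS hP => z hz Az; apply: hz => //; exact: AB.
by [].
Qed.

Lemma within_continuous_pair (T V W : topologicalType) (A : set T)
    (f : T -> V) (h : T -> W) :
  {within A, continuous f} -> {within A, continuous h} ->
  {within A, continuous (fun x => (f x, h x))}.
Proof.
move=> /subspace_continuousP cf /subspace_continuousP ch.
apply/subspace_continuousP => x Ax.
have FA : Filter (within A (nbhs x)) by exact: within_filter.
exact: (@cvg_pair _ _ _ _ (nbhs (f x)) (nbhs (h x)) FA _ _ _ _ (cf x Ax) (ch x Ax)).
Qed.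

Section partial_continuity.
Variables (T V W : topologicalType) (A : set T) (B : set V) (F : T -> V -> W).
Hypothesis cF : {within A `*` B, continuous (fun p : T * V => F p.1 p.2)}.

Lemma within_continuous_partial1 y : B y -> {within A, continuous (F ^~ y)}.
Proof.
move=> By; have := within_continuous_subset_comp (A := A) (f := fun x => (x, y)) _ _ cF.
apply; last by move=> x Ax; split.
apply: within_continuous_pair; last exact: cst_continuous.
by apply: continuous_subspaceT => x; exact: cvg_id.
Qed.

Lemma within_continuous_partial2 x : A x -> {within B, continuous (F x)}.
Proof.
move=> Ax; have := within_continuous_subset_comp (A := B) (f := fun y => (x, y)) _ _ cF.
apply; last by move=> y By; split.
apply: within_continuous_pair; first exact: cst_continuous.
by apply: continuous_subspaceT => y; exact: cvg_id.
Qed.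

End partial_continuity.

(** * Comparison functions *)

Section comparison_function_theory.
Variable R : realType.
Implicit Types (h : R -> R) (beta : R -> R -> R).

Lemma class_K_lt h r s : class_K h -> 0 <= r -> r < s -> h r < h s.
Proof.
move=> [_ _ hh] r0 rs; apply: hh => //; rewrite in_itv/= andbT//.
exact: le_trans (ltW rs).
Qed.

Lemma class_K_le h r s : class_K h -> 0 <= r -> r <= s -> h r <= h s.
Proof.
by move=> Kh r0; rewrite le_eqVlt => /predU1P[->//|rs]; exact/ltW/class_K_lt.
Qed.

Lemma class_K_ge0 h r : class_K h -> 0 <= r -> 0 <= h r.
Proof. by move=> Kh r0; have [_ <- _] := Kh; exact: class_K_le. Qed.

Lemma class_KL_ge0 beta r t : class_KL beta -> 0 <= r -> 0 <= t ->
  0 <= beta r t.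
Proof. by move=> [_ Kb _] r0 t0; exact: (class_K_ge0 (Kb t t0)). Qed.

Lemma class_KL_le beta r r' t : class_KL beta -> 0 <= r -> r <= r' -> 0 <= t ->
  beta r t <= beta r' t.
Proof. by move=> [_ Kb _] r0 rr' t0; exact: (class_K_le (Kb t t0)). Qed.

Lemma class_KL_ge beta r t t' : class_KL beta -> 0 <= r -> 0 <= t -> t <= t' ->
  beta r t' <= beta r t.
Proof.
move=> [_ Kb Lb] r0 t0; rewrite le_eqVlt => /predU1P[->//|tt'].
have t'0 : 0 <= t' by rewrite (le_trans t0)// ltW.
move: r0; rewrite le_eqVlt => /predU1P[<-|r0].
  by have [_ -> _] := Kb t t0; have [_ -> _] := Kb t' t'0.
by have [_ hb _] := Lb r r0; apply/ltW/hb => //; rewrite in_itv/= andbT.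
Qed.

Lemma class_K_scale h (c : R) : 0 < c -> class_K h -> class_K (fun r => c * h r).
Proof.
move=> c0 [ch h0 hh]; split.
- apply/subspace_continuousP => x x0; apply: cvgMr.
  by move/subspace_continuousP : ch; exact.
- by rewrite h0 mulr0.
- by move=> r s r0 s0 rs; rewrite ltr_pM2l// hh.
Qed.

(** Supplies the summands of the final KL bound, with [c] a power of 2. *)
Lemma class_KL_scale_comp beta h (a c : R) : class_KL beta -> class_K h ->
  0 < a -> 0 < c -> class_KL (fun r t => a * beta (h r) (t / c)).
Proof.
move=> KLb Kh a0 c0; have [cb Kb Lb] := KLb; have [ch h0 hh] := Kh.
have tc0 t : 0 <= t -> 0 <= t / c by move=> t0; rewrite divr_ge0// ltW.
have cb' : {within (`[0, +oo[ `*` `[0, +oo[ : set (R * R)),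
    continuous (fun p : R * R => a * beta (h p.1) (p.2 / c))}.
  have : {within (`[0, +oo[ `*` `[0, +oo[ : set (R * R)),
      continuous ((fun p : R * R => beta p.1 p.2) \o
        (fun p : R * R => (h p.1, p.2 / c)))}.
    apply: within_continuous_subset_comp cb => [|[r t]]; last first.
      rewrite /= !in_itv/= !andbT => -[r0 t0]; split; last exact: tc0.
      exact: class_K_ge0.
    apply: within_continuous_pair.
      apply: within_continuous_subset_comp ch => [|? []//].
      by apply: continuous_subspaceT => p; exact: cvg_fst.
    apply: continuous_subspaceT => p.
    by apply: cvgMl; exact: cvg_snd.
  move=> /subspace_continuousP c'; apply/subspace_continuousP => p Ap.
  by apply: cvgMr; exact: c'.
split=> // [t t0|r r0].
  split.
  - by apply: (within_continuous_partial1 (F := fun r t : R => a * beta (h r) (t / c)) cb'); rewrite /= in_itv/= t0.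
  - by rewrite h0; have [_ -> _] := Kb _ (tc0 _ t0); rewrite mulr0.
  - move=> r s; rewrite !in_itv/= !andbT => r0 s0 rs; rewrite ltr_pM2l//.
    apply: class_K_lt (Kb _ (tc0 _ t0)) _ _; first exact: class_K_ge0.
    exact: class_K_lt.
have hr0 : 0 < h r by rewrite -h0; exact: class_K_lt.
have [_ Lh Lc] := Lb _ hr0.
split.
- by apply: (within_continuous_partial2 (F := fun r t : R => a * beta (h r) (t / c)) cb'); rewrite /= in_itv/= ltW.
- move=> t t'; rewrite !in_itv/= !andbT => t0 t'0 tt'; rewrite ltr_pM2l//.
  apply: Lh; rewrite ?in_itv/= ?andbT ?tc0//.
  by rewrite ltr_pM2r// invr_gt0.
- rewrite -[X in _ --> X](mulr0 a); apply: cvgMr.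
  apply: cvg_comp Lc; apply: gt0_cvgMly => //; first by rewrite invr_gt0.
Qed.

(** * Geometrically weighted series of KL functions *)

Section weighted_series.
Variable lambda : R.
Hypotheses (lambda_ge0 : 0 <= lambda) (lambda_lt1 : lambda < 1).

Definition wpartial (f : nat -> R) (n : nat) : R := \sum_(k < n) lambda ^+ k * f k.

Definition wseries (f : nat -> R) : R := limn (wpartial f).

Lemma wpartial_nondecreasing f : (forall k, 0 <= f k) ->
  nondecreasing_seq (wpartial f).
Proof.
move=> f0; apply/nondecreasing_seqP => n.
by rewrite /wpartial big_ord_recr /= lerDl mulr_ge0 ?exprn_ge0.
Qed.

(** The added terms are at most a finite geometric sum; keeping its exact value, with the
    [lambda ^+ m] term, closes the induction on [m]. *)
Lemma wpartial_tail f b m n : (forall k, f k <= b) -> (n <= m)%N ->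
  wpartial f m <= wpartial f n + lambda ^+ n * (b / (1 - lambda)) -
    lambda ^+ m * (b / (1 - lambda)).
Proof.
move=> fb nm; rewrite lerBrDr.
elim: m nm => [|m IH]; first by rewrite leqn0 => /eqP ->.
rewrite leq_eqVlt => /predU1P[->//|/IH]; apply: le_trans.
rewrite /wpartial big_ord_recr /= -addrA lerD2l exprS.
have l0 : 1 - lambda != 0 by rewrite subr_eq0 gt_eqF.
have -> : lambda * lambda ^+ m * (b / (1 - lambda)) =
    lambda ^+ m * (b / (1 - lambda)) - lambda ^+ m * b by field.
by rewrite addrCA gerDl subr_le0 ler_wpM2l// exprn_ge0.
Qed.

Lemma wpartial_le f b n : 0 <= b -> (forall k, f k <= b) ->
  wpartial f n <= b / (1 - lambda).
Proof.
move=> b0 fb; have := wpartial_tail fb (leq0n n).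
rewrite {2}/wpartial big_ord0 add0r mul1r => /le_trans; apply.
by rewrite gerBl mulr_ge0 ?exprn_ge0// divr_ge0// subr_ge0 ltW.
Qed.

Lemma is_cvg_wpartial f b : (forall k, 0 <= f k <= b) -> cvgn (wpartial f).
Proof.
move=> fb; have f0 k : 0 <= f k by have /andP[] := fb k.
have b0 : 0 <= b by exact: le_trans (f0 0%N) (andP (fb 0%N)).2.
apply: nondecreasing_is_cvgn; first exact: wpartial_nondecreasing.
exists (b / (1 - lambda)) => _ [n _ <-].
by apply: wpartial_le => // k; have /andP[] := fb k.
Qed.

(** The truncation error depends on [f] only through [b], which gives uniform approximation by
    partial sums. *)
Lemma wseries_bounds f b n : (forall k, 0 <= f k <= b) ->
  wpartial f n <= wseries f <= wpartial f n + lambda ^+ n * (b / (1 - lambda)).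
Proof.
move=> fb; have f0 k : 0 <= f k by have /andP[] := fb k.
have b0 : 0 <= b by exact: le_trans (f0 0%N) (andP (fb 0%N)).2.
have cf := is_cvg_wpartial fb.
rewrite nondecreasing_cvgn_le//=; last exact: wpartial_nondecreasing.
apply: limr_le => //; near=> m.
apply: le_trans (wpartial_tail (n := n) _ _) _.
- by move=> k; have /andP[_] := fb k; exact.
- by near: m; exists n.
by rewrite gerBl mulr_ge0 ?exprn_ge0// divr_ge0// subr_ge0 ltW.
Unshelve. all: by end_near. Qed.

(** The term [k = 0] has weight 1, so its gap bounds from below the difference of all nonempty
    partial sums and survives the limit. *)
Lemma lt_wseries f f' b : (forall k, 0 <= f k <= f' k) -> (forall k, f' k <= b) ->
  f 0%N < f' 0%N -> wseries f < wseries f'.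
Proof.
move=> ff' f'b f0.
have fb k : 0 <= f k <= b.
  by have /andP[-> h] := ff' k; exact: le_trans (f'b k).
have f'b' k : 0 <= f' k <= b.
  by rewrite f'b andbT; have /andP[+ h] := ff' k; move/le_trans; exact.
rewrite -subr_gt0 (lt_le_trans (y := f' 0%N - f 0%N)) ?subr_gt0//.
have cf := is_cvg_wpartial fb; have cf' := is_cvg_wpartial f'b'.
rewrite /wseries -limB//; apply: limr_ge; first exact: is_cvgB.
exists 1%N => // -[//|n] _.
suff : f' 0%N - f 0%N <= wpartial f' n.+1 - wpartial f n.+1 by [].
rewrite /wpartial !big_ord_recl /= expr0 !mul1r.
rewrite opprD addrACA lerDl subr_ge0 ler_sum// => k _.
by rewrite ler_wpM2l ?exprn_ge0//; have /andP[] := ff' (bump 0 k).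
Qed.

Lemma exists_small_tail (b e : R) : 0 < e ->
  exists n, lambda ^+ n * b < e.
Proof.
move=> e0; have : lambda ^+ n * b @[n --> \oo] --> 0.
  under eq_fun do rewrite mulrC.
  by apply: (@cvg_geometric R b); rewrite ger0_norm.
move=> /cvgrPdist_lt/(_ e e0)[n _ /(_ n (leqnn n))] /=.
by rewrite sub0r normrN => /(le_lt_trans (ler_norm _)); exists n.
Qed.

(** The majorant [B] makes the convergence uniform in [t] and locally uniform in [r], so joint
    continuity and decay pass from the partial sums to the series; strict monotonicity comes from
    the term [k = 0]. *)
Lemma class_KL_wseries (b : nat -> R -> R -> R) (B : R -> R) :
  (forall k, class_KL (b k)) -> class_K B ->
  (forall k r t, 0 <= r -> 0 <= t -> b k r t <= B r) ->
  class_KL (fun r t => wseries (fun k => b k r t)).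
Proof.
move=> KLb KB bB.
have bb r t k : 0 <= r -> 0 <= t -> 0 <= b k r t <= B r.
  by move=> r0 t0; rewrite class_KL_ge0//= bB.
have cw n : {within (`[0, +oo[ `*` `[0, +oo[ : set (R * R)),
    continuous (fun p : R * R => wpartial (fun k => b k p.1 p.2) n)}.
  elim: n => [|n IH].
    rewrite (_ : (fun p => _) = fun=> 0); first exact: cst_continuous.
    by apply/funext => p; rewrite /wpartial big_ord0.
  rewrite (_ : (fun p => _) = fun p : R * R => wpartial (fun k => b k p.1 p.2) n +
      lambda ^+ n * b n p.1 p.2).
    move=> p; apply: cvgD; first exact: IH.
    by apply: cvgMr; have [c _ _] := KLb n; exact: c.
  by apply/funext => p; rewrite /wpartial big_ord_recr.
have cs : {within (`[0, +oo[ `*` `[0, +oo[ : set (R * R)),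
    continuous (fun p : R * R => wseries (fun k => b k p.1 p.2))}.
  apply/subspace_continuousP => p Ap; apply/cvgrPdist_lt => e e0.
  have [p10 p20] : 0 <= p.1 /\ 0 <= p.2.
    by case: Ap; rewrite /= !in_itv/= !andbT.
  have e30 : 0 < e / 3 by rewrite divr_gt0.
  (* Taking [B] at [p.1 + 1] lets one [n] control the tails at all points near [p]. *)
  have [n hn] := exists_small_tail (B (p.1 + 1) / (1 - lambda)) e30.
  have tail q : 0 <= q.1 -> 0 <= q.2 -> q.1 <= p.1 + 1 ->
      `|wseries (fun k => b k q.1 q.2) - wpartial (fun k => b k q.1 q.2) n|
        < e / 3.
    move=> q10 q20 q11; have /andP[lo hi] := wseries_bounds n (fun k => bb _ _ k q10 q20).
    rewrite ger0_norm ?subr_ge0// (le_lt_trans _ hn)// lerBlDl (le_trans hi)//.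
    rewrite lerD2l ler_wpM2l ?exprn_ge0// ler_wpM2r//; last exact: class_K_le.
    by rewrite invr_ge0 subr_ge0 ltW.
  move/subspace_continuousP : (cw n) => /(_ p Ap)/cvgrPdist_lt/(_ _ e30) cp.
  have near_p : \forall q \near p, q.1 <= p.1 + 1.
    have c1 : q.1 @[q --> p] --> p.1 by exact: cvg_fst.
    apply: (c1 [set x | x <= p.1 + 1]); have : p.1 < p.1 + 1 by rewrite ltrDl.
    by move=> /lt_nbhsl; apply: filterS => x /ltW.
  near=> q.
  have [q10 q20] : 0 <= q.1 /\ 0 <= q.2.
    have : (`[0, +oo[ `*` `[0, +oo[)%classic q by near: q; exact: withinT.
    by case; rewrite /= !in_itv/= !andbT.
  have q11 : q.1 <= p.1 + 1.
    by near: q; exact: cvg_within near_p.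
  have := tail p p10 p20 _; rewrite lerDl ler01 => /(_ isT).
  have := tail q q10 q20 q11.
  have : `|wpartial (fun k => b k p.1 p.2) n - wpartial (fun k => b k q.1 q.2) n|
    < e / 3 by near: q.
  rewrite /from_subspace /= !ltr_norml => /andP[? ?] /andP[? ?] /andP[? ?].
  by apply/andP; split; lra.
split=> // [t t0|r r0].
  split.
  - by apply: (within_continuous_partial1
      (F := fun r t : R => wseries (fun k => b k r t)) cs); rewrite /= in_itv/= t0.
  - rewrite /wseries (_ : wpartial _ = fun=> 0) ?lim_cst//.
    apply/funext => n; rewrite /wpartial big1// => k _.
    by have [_ /(_ _ t0)[_ -> _] _] := KLb k; rewrite mulr0.
  - move=> r s; rewrite !in_itv/= !andbT => r0 s0 rs.
    apply: (@lt_wseries _ _ (B s)) => [k|k|]; last first.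
    + by have [_ Kb _] := KLb 0%N; exact: class_K_lt (Kb _ t0) _ _.
    + exact: bB.
    + by rewrite class_KL_ge0// class_KL_le// ltW.
have r0' := ltW r0.
split.
- by apply: (within_continuous_partial2
      (F := fun r t : R => wseries (fun k => b k r t)) cs); rewrite /= in_itv/= ltW.
- move=> t t'; rewrite !in_itv/= !andbT => t0 t'0 tt'.
  apply: (@lt_wseries _ _ (B r)) => [k|k|]; last first.
  + by have [_ _ Lb] := KLb 0%N; have [_ Lh _] := Lb _ r0; apply: Lh => //;
      rewrite in_itv/= andbT.
  + exact: bB.
  + by rewrite class_KL_ge0// class_KL_ge// ltW.
- apply/cvgrPdist_lt => e e0; have e20 : 0 < e / 2 by rewrite divr_gt0.
  (* This [n] serves all [t], and the remaining finite sum tends to 0 termwise. *)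
  have [n hn] := exists_small_tail (B r / (1 - lambda)) e20.
  have : wpartial (fun k => b k r t) n @[t --> +oo] --> 0.
    elim: {hn} n => [|n IH].
      rewrite (_ : (fun t => _) = fun=> 0); first exact: cvg_cst.
      by apply/funext => t; rewrite /wpartial big_ord0.
    rewrite (_ : (fun t => _) = fun t => wpartial (fun k => b k r t) n +
        lambda ^+ n * b n r t); last first.
      by apply/funext => t; rewrite /wpartial big_ord_recr.
    rewrite -[X in _ --> X](addr0 0); apply: cvgD => //.
    rewrite -[X in _ --> X](mulr0 (lambda ^+ n)); apply: cvgMr.
    by have [_ _ /(_ _ r0)[]] := KLb n.
  move=> /cvgrPdist_lt/(_ _ e20) wn; near=> t.
  have t0 : 0 <= t by near: t; exact: nbhs_pinfty_ge.
  have /andP[lo hi] := wseries_bounds n (fun k => bb _ _ k r0' t0).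
  have w0 : 0 <= wpartial (fun k => b k r t) n.
    by apply: sumr_ge0 => k _; rewrite mulr_ge0 ?exprn_ge0// class_KL_ge0.
  rewrite sub0r normrN ger0_norm ?(le_trans w0)//.
  apply: (le_lt_trans hi); rewrite [e]splitr ltrD//.
  rewrite (le_lt_trans (ler_norm _))// -normrN -sub0r.
  by near: t.
Unshelve. all: by end_near. Qed.

End weighted_series.

End comparison_function_theory.

(** * The small-gain argument for a scalar estimate *)

Section small_gain.
Variables (R : realType) (X : normedModType R) (U : lmodType R).
Variables (UU : input_space U) (S : control_system X UU).
Implicit Types (x : X) (u : UU) (t s : {nonneg R}).

Lemma flow_dom_le t s x u : flow_dom S t x u -> s%:num <= t%:num ->
  flow_dom S s x u.
Proof. by move=> dt st; apply: le_lt_trans dt; rewrite lee_fin. Qed.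

(** By continuity on a compact interval; this makes the supremum of [V] finite before it is
    absorbed. *)
Lemma flow_bounded t x u : flow_dom S t x u ->
  exists M, forall s, s%:num <= t%:num -> `|flow S s x u| <= M.
Proof.
move=> dt; pose w := half_line (fun s => flow S s x u).
have cw : {within `[0, t%:num], continuous (fun r => `|w r|)}.
  have sub r : `[0, t%:num]%classic r -> 0 <= r /\ (r%:E < tmax S x u)%E.
    rewrite /= in_itv/= => /andP[r0 rt]; split=> //.
    by apply: le_lt_trans dt; rewrite lee_fin.
  apply: (@within_continuous_subset_comp _ _ _ _ setT w Num.norm) => //; last first.
    by apply: continuous_subspaceT; exact: norm_continuous.
  apply: continuous_subspaceW (@flow_continuous _ _ _ _ S x u).
  by move=> r /sub.
have [c _ hc] := EVT_max (ge0 t) cw.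
exists `|w c| => s st; have := hc s%:num.
by rewrite in_itv/= ge0 st /w /half_line nnpart_num; exact.
Qed.

Variables (V : X -> R) (C lambda : R) (beta : R -> R -> R) (gamma : R -> R).
Hypotheses (S_BIC : BIC S) (lambda_ge0 : 0 <= lambda) (lambda_lt1 : lambda < 1).
Hypotheses (C_gt0 : 0 < C) (le_CV : forall x, `|x| <= C * V x).
Hypothesis V_le : forall x, V x <= `|x|.
Hypotheses (beta_KL : class_KL beta) (gamma_K : class_K gamma).
(** Letting [M] be any bound, rather than the supremum, allows both the supremum and the inductive
    bounds of the decay estimate to be inserted. *)
Hypothesis V_flow : forall t x u M, flow_dom S t x u ->
  (forall s, s%:num <= t%:num -> V (flow S s x u) <= M) ->
  V (flow S t x u) <= beta `|x| t%:num + lambda * M + gamma `|u|.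

(** Taking [M = sup A] at every time up to [t] bounds [sup A] by itself times [lambda] plus
    constants, and [lambda < 1] allows solving for it. *)
Lemma small_gain_bounded t x u : flow_dom S t x u ->
  V (flow S t x u) <= (beta `|x| 0 + gamma `|u|) / (1 - lambda).
Proof.
move=> dt; have [M hM] := flow_bounded dt.
pose A := [set V (flow S s x u) | s in [set s : {nonneg R} | s%:num <= t%:num]].
have ubA : has_ubound A.
  by exists M => _ [s /= st <-]; apply: le_trans (hM s st).
have A0 : A !=set0 by exists (V (flow S t x u)), t => /=.
have le_sup s : s%:num <= t%:num -> V (flow S s x u) <= sup A.
  by move=> st; apply: ub_le_sup => //; exists s.
apply: le_trans (le_sup t (lexx _)) _.
rewrite ler_pdivlMr ?subr_gt0//.
suff : sup A <= beta `|x| 0 + lambda * sup A + gamma `|u| by nra.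
apply: ge_sup => // _ [s /= st <-].
apply: le_trans (V_flow (flow_dom_le dt st) (M := sup A) _) _.
  by move=> s' s's; apply: le_sup; exact: le_trans st.
by rewrite !lerD2r class_KL_ge.
Qed.

(** At a finite escape time BIC would push the norm above every level, against the a priori bound
    [K]. *)
Lemma small_gain_complete t x u : flow_dom S t x u.
Proof.
apply: contrapT => /negP; rewrite -leNgt => tm.
have tmy : (tmax S x u < +oo)%E by apply: le_lt_trans tm _; exact: ltry.
pose K := C * ((beta `|x| 0 + gamma `|u|) / (1 - lambda)).
have K0 : 0 <= K.
  apply: mulr_ge0; first exact: ltW.
  apply: divr_ge0; last by rewrite subr_ge0 ltW.
  by apply: addr_ge0; [exact: class_KL_ge0 | exact: class_K_ge0].
(* BIC asks for a positive level, while [K] may be 0. *)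
have K1 : 0 < K + 1 by rewrite ltr_wpDl.
have [s ds] := S_BIC tmy K1; apply/negP; rewrite -leNgt.
rewrite (le_trans (le_CV _))// (@le_trans _ _ K) ?lerDl//.
by rewrite ler_pM2l// small_gain_bounded.
Qed.

(** Induction on [n] by restarting at time [r / 2]. Separating [r] from [t] makes the bound hold at
    all times after [r], so the induction hypothesis at [r / 2] covers the whole restarted
    trajectory. *)
Lemma small_gain_decay x u K n : (forall t, V (flow S t x u) <= K) ->
  forall (r : R) t, 0 <= r -> r <= t%:num ->
  V (flow S t x u) <=
    wpartial lambda (fun k => beta (C * K) (r / 2 ^+ k.+1) + gamma `|u|) n
      + lambda ^+ n * K.
Proof.
move=> VK; elim: n => [|n IH] r t r0 rt.
  by rewrite /wpartial big_ord0 add0r mul1r.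
have r20 : 0 <= r / 2 by rewrite divr_ge0.
have r2r : r / 2 <= r by rewrite ler_pdivrMr// ler_peMr// ler1n.
(* The time [h] left after the restart is at least [r / 2], as the decay of [beta] requires. *)
pose s : {nonneg R} := nnpart (r / 2); pose h : {nonneg R} := nnpart (t%:num - r / 2).
have sE : s%:num = r / 2 by exact: nnpartE.
have hE : h%:num = t%:num - r / 2.
  by apply: nnpartE; rewrite subr_ge0 (le_trans r2r).
have coc h' : flow_dom S h' (flow S s x u) (inp_shift s u) /\
    flow S h' (flow S s x u) (inp_shift s u) = flow S (s%:num + h'%:num)%:nng x u.
  by apply: flow_cocycle; exact: (small_gain_complete (s%:num + h'%:num)%:nng).
have tE : t = (s%:num + h%:num)%:nng.
  by apply/val_inj; rewrite /= sE hE addrC subrK.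
have := V_flow (M := wpartial lambda
    (fun k => beta (C * K) (r / 2 / 2 ^+ k.+1) + gamma `|u|) n + lambda ^+ n * K)
  (coc h).1 _.
rewrite (coc h).2 -tE.
have IHs s' : s'%:num <= h%:num -> V (flow S s' (flow S s x u) (inp_shift s u))
   <= wpartial lambda (fun k => beta (C * K) (r / 2 / 2 ^+ k.+1) + gamma `|u|) n
      + lambda ^+ n * K.
  by move=> _; rewrite (coc s').2; apply: IH => //; rewrite -[r / 2]sE lerDl.
move=> /(_ IHs)/le_trans; apply.
have K0 : 0 <= C * K.
  by apply: le_trans (ler_wpM2l (ltW C_gt0) (VK t)); apply: le_trans (le_CV _).
have b1 : beta `|flow S s x u| h%:num <= beta (C * K) (r / 2).
  apply: le_trans (_ : beta (C * K) h%:num <= _).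
    by apply: class_KL_le => //; rewrite (le_trans (le_CV _))// ler_pM2l.
  by apply: class_KL_ge => //; rewrite hE; lra.
have g1 : gamma `|inp_shift s u| <= gamma `|u|.
  by apply: class_K_le => //; exact: inp_shift_norm.
(* The term [k = 0] comes from the restart; the others are [lambda] times the sum at [r / 2], as
   halving [r] shifts the exponent of 2 by one. *)
rewrite {2}/wpartial big_ord_recl /= expr0 expr1 mul1r [lambda ^+ n.+1]exprS.
suff -> : \sum_(i < n) lambda ^+ bump 0 i *
   (beta (C * K) (r / 2 ^+ (bump 0 i).+1) + gamma `|u|) =
   lambda * wpartial lambda
     (fun k => beta (C * K) (r / 2 / 2 ^+ k.+1) + gamma `|u|) n.
  by lra.
rewrite /wpartial mulr_sumr; apply: eq_bigr => i _.
by rewrite /bump add1n exprS -mulrA -[r / 2 / _]mulrA -invfM -exprS.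
Qed.

(* With [M t] the supremum of [V] after time [t] and [K] a bound on [V], the
   cocycle property gives [M t <= beta (C K) (t / 2) + lambda * M (t / 2) + gamma |u|],
   hence [M t <= \sum_k lambda ^ k * beta (C K) (t / 2 ^ (k + 1)) + gamma |u| / (1 - lambda)].
   The bound [K] depends on the state alone unless [gamma |u|] dominates
   [beta |x| 0], in which case boundedness suffices. *)
Lemma small_gain_ISS : ISS S.
Proof.
have l0 : 0 < 1 - lambda by rewrite subr_gt0.
(* The 2 bounds [beta r 0 + G] by twice the larger summand. *)
pose q := 2 / (1 - lambda).
have q0 : 0 < q by rewrite divr_gt0.
(* This is [C * K] for the bound [K = q * beta r 0] on [V]. *)
pose h r := C * q * beta r 0.
have Kh : class_K h.
  by apply: class_K_scale; [rewrite mulr_gt0 | have [_ /(_ 0 (lexx _))] := beta_KL].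
pose b k (r t : R) := C * beta (h r) (t / 2 ^+ k.+1).
pose B r := C * beta (h r) (0 / 1).
have bB k (r t : R) : 0 <= r -> 0 <= t -> b k r t <= B r.
  move=> r0 t0; rewrite ler_pM2l// mul0r class_KL_ge//; first exact: class_K_ge0.
  by rewrite divr_ge0.
have KLb k : class_KL (b k) by apply: class_KL_scale_comp.
have KB : class_K B.
  have [_ /(_ 0 (lexx _))] := class_KL_scale_comp beta_KL Kh C_gt0 ltr01.
  by [].
exists (fun r t : R => wseries lambda (fun k => b k r t)), (fun s : R => C * q * gamma s).
split; first exact (class_KL_wseries lambda_ge0 lambda_lt1 KLb KB bB).
  by left; apply: (class_K_scale _ gamma_K); exact: mulr_gt0.
move=> t x u dt; set G := gamma `|u|; set r := `|x|.
have G0 : 0 <= G by exact: class_K_ge0.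
have r0 : 0 <= r by exact: normr_ge0.
have b0 : 0 <= beta r 0 by exact: class_KL_ge0.
have bb k : 0 <= b k r t%:num <= B r by rewrite class_KL_ge0//= bB.
have Vle s : V (flow S s x u) <= (beta r 0 + G) / (1 - lambda).
  exact/small_gain_bounded/small_gain_complete.
apply: le_trans (le_CV _) _.
have [bG|Gb] := leP (beta r 0) G.
  rewrite -[leLHS]add0r lerD//.
    have /andP[+ _] := wseries_bounds lambda_ge0 lambda_lt1 0 bb.
    by rewrite /wpartial big_ord0.
  rewrite -mulrA ler_pM2l// (le_trans (Vle _))// /q mulrAC ler_pM2r ?invr_gt0//.
  by lra.
have VK s : V (flow S s x u) <= q * beta r 0.
  rewrite (le_trans (Vle _))// /q mulrAC ler_pM2r ?invr_gt0//; lra.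
(* The slack [e] absorbs the remainder [lambda ^+ n * K], with [n] chosen after [e]. *)
apply/ler_addgt0Pr => e e0.
have [n hn] := exists_small_tail lambda_ge0 lambda_lt1 (C * (q * beta r 0)) e0.
have t0 : 0 <= t%:num by [].
have := small_gain_decay n VK t0 (lexx t%:num).
rewrite -(ler_pM2l C_gt0) => /le_trans; apply.
rewrite mulrDr [C * (lambda ^+ n * _)]mulrCA lerD ?(ltW hn)//.
have -> : C * wpartial lambda
     (fun k => beta (C * (q * beta r 0)) (t%:num / 2 ^+ k.+1) + G) n =
   wpartial lambda (fun k => b k r t%:num) n + wpartial lambda (fun=> C * G) n.
  rewrite /wpartial mulr_sumr -big_split/=; apply: eq_bigr => k _.
  by rewrite /b /h -[C * q * _]mulrA; ring.
apply: lerD.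
  by have /andP[] := wseries_bounds lambda_ge0 lambda_lt1 n bb.
have CG0 : 0 <= C * G by rewrite mulr_ge0// ltW.
(* The input terms sum to at most [C * G / (1 - lambda)], half of the gain [C * q * G]. *)
apply: le_trans (wpartial_le lambda_ge0 lambda_lt1 n CG0 (fun=> lexx _)) _.
have -> : C * q * G = 2 * (C * G / (1 - lambda)) by rewrite /q; ring.
by rewrite ler_peMl ?ler1n// divr_ge0// ltW.
Qed.

End small_gain.

(** * The weighted supremum norm *)

Section weighted_norm.
Variables (R : realType) (I : Type) (X : I -> normedModType R) (i0 : I).
Variables (eta : I -> R) (C : R).
Hypothesis eta_bounds : forall i, 1 <= eta i <= C.
Implicit Types x : bfam X.

Definition weighted_norm x : R := sup (range (fun i => `|x i| / eta i)).

Let eta_gt0 i : 0 < eta i.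
Proof. by apply: lt_le_trans (andP (eta_bounds i)).1. Qed.

(** The index [i0] makes the range nonempty, so its supremum is a genuine least upper bound. *)
Lemma weighted_norm_le x (M : R) : (forall i, `|x i| <= eta i * M) ->
  weighted_norm x <= M.
Proof.
move=> xM; apply: ge_sup => [|_ [i _ <-]]; first by exists (`|x i0| / eta i0), i0.
by rewrite ler_pdivrMr// mulrC.
Qed.

Lemma weighted_norm_ub x i : `|x i| <= eta i * weighted_norm x.
Proof.
rewrite mulrC -ler_pdivrMr//; apply: ub_le_sup; last by exists i.
exists `|x| => _ [j _ <-]; have /andP[e1 _] := eta_bounds j.
rewrite ler_pdivrMr// (le_trans (bf_norm_ub x j))//.
by rewrite ler_peMr//; exact: bf_norm_ge0.
Qed.

Lemma weighted_norm_le_norm x : weighted_norm x <= `|x|.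
Proof.
apply: weighted_norm_le => i; have /andP[e1 _] := eta_bounds i.
by rewrite (le_trans (bf_norm_ub x i))// ler_peMl//; exact: bf_norm_ge0.
Qed.

Lemma weighted_norm_ge0 x : 0 <= weighted_norm x.
Proof.
rewrite -(pmulr_rge0 _ (eta_gt0 i0)).
by apply: le_trans (weighted_norm_ub x i0).
Qed.

Lemma norm_le_weighted_norm x : `|x| <= C * weighted_norm x.
Proof.
have /andP[e1 eC] := eta_bounds i0; have V0 := weighted_norm_ge0 x.
apply: (bf_norm_le (x := x)) => [|i].
  by rewrite mulr_ge0// (le_trans ler01)// (le_trans e1).
apply: le_trans (weighted_norm_ub x i) _.
by rewrite ler_wpM2r//; have /andP[] := eta_bounds i.
Qed.

End weighted_norm.

(** * The scalar estimate for the interconnection *)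

(** Passes from the sums over [j != i] in the subsystem estimates to the full rows of the gain
    operator. *)
Lemma esum_subtype_le (R : realType) (T : choiceType) (P : pred T)
    (a : T -> \bar R) : (forall x, 0 <= a x)%E ->
  (\esum_(x in [set: {x | P x}]) a (val x) <= \esum_(x in [set: T]) a x)%E.
Proof.
move=> a0; rewrite -(@esum_image _ _ _ setT val); last by move=> x y _ _; exact: val_inj.
by rewrite esum_mkcond; apply: le_esum => x _; case: ifP.
Qed.

(** Each component is a subsystem trajectory driven by the others, whose norms on [[0, t]] are at
    most [eta j * M]; linearity of the gains and the subeigenvector inequality then collapse the sum
    to [lambda * eta i * M]. *)
Lemma interconnection_estimate (R : realType) (I : countType)
    (X : I -> normedModType R) (U : lmodType R) (UU : input_space U)
    (Sigma_ : forall i, subsystem X UU i) (Sigma : control_system (bfam X) UU)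
    (i : I) (beta : R -> R -> R) (gamma : I -> R -> R) (gammau : R -> R)
    (g eta : I -> R) (lambda : R) (t : {nonneg R}) (x : bfam X) (u : UU) (M : R) :
  solves Sigma_ (pf_of Sigma) ->
  ISS_sum (Sigma_ i) beta gamma gammau ->
  (forall j, 0 <= g j) -> (forall j r, 0 <= r -> gamma j r = g j * r) ->
  (forall j, 0 < eta j) ->
  (\esum_(j in [set: I]) (g j * eta j)%:E <= (lambda * eta i)%:E)%E ->
  flow_dom Sigma t x u ->
  (forall s : {nonneg R}, s%:num <= t%:num ->
     forall j, `|flow Sigma s x u j| <= eta j * M) ->
  `|flow Sigma t x u i| <=
    beta `|x i| t%:num + lambda * eta i * M + gammau `|u|.
Proof.
move=> [_ Ssol] [_ _ _ _ Siss] g0 gE eta0 geta dt SM.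
have [w [wE _ ->]] := Ssol t x u i dt.
have M0 : 0 <= M.
  by rewrite -(pmulr_rge0 _ (eta0 i)); apply: le_trans (SM t (lexx _) i).
(* Up to time [t], which is all that [comp_norm] sees, [w] is the restricted flow. *)
have wM s j : s%:num <= t%:num -> `|w s j| <= eta (val j) * M.
  by move=> st; have [_ ->] := wE s st; exact: SM.
have nM j : 0 <= comp_norm w t j <= eta (val j) * M.
  apply/andP; split.
    apply: (@le_trans _ _ `|w t j|) => //.
    apply: ub_le_sup; last by exists t => /=.
    by exists (eta (val j) * M) => _ [s /= st <-]; exact: wM.
  by apply: ge_sup => [|_ [s /= st <-]]; [exists `|w t j|, t => /= | exact: wM].
rewrite -lee_fin !EFinD; apply: le_trans (Siss (x i) w u t) _.
apply: leeD => //; apply: leeD => //.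
apply: (@le_trans _ _ (\esum_(j in [set: {j | j != i}])
    (M * (g (val j) * eta (val j)))%:E)%E).
  apply: le_esum => j _; have /andP[n0 n1] := nM j.
  rewrite lee_fin gE// mulrCA ler_wpM2l//.
  by rewrite mulrC.
have ge0 j : 0 <= g j * eta j by rewrite mulr_ge0// ltW.
apply: le_trans (le_esumZ M0 _) _ => //.
rewrite [(lambda * eta i * M)%R]mulrC EFinM lee_wpmul2l ?lee_fin//.
apply: le_trans geta.
by apply: (@esum_subtype_le _ _ (fun j => j != i) (fun j => (g j * eta j)%:E)).
Qed.

Theorem corollary6p6 (R : realType) (I : countType) (i0 : I)
    (X : I -> normedModType R) (U : lmodType R) (UU : input_space U)
    (Sigma_ : forall i, subsystem X UU i)
    (Sigma_complete : forall i, forward_complete (Sigma_ i))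
    (Sigma : control_system (bfam X) UU)
    (Sigma_interconnection : is_interconnection Sigma_ Sigma)
    (beta : I -> R -> R -> R) (gamma : I -> I -> R -> R) (gammau : I -> R -> R)
    (Sigma_ISS : forall i, ISS_sum (Sigma_ i) (beta i) (gamma i) (gammau i))
    (betamax : R -> R -> R) (gammamax : R -> R)
    (betamax_KL : class_KL betamax) (gammamax_K : class_K gammamax)
    (beta_le : forall i (r t : R), 0 <= r -> 0 <= t -> beta i r t <= betamax r t)
    (gammau_le : forall i (r : R), 0 <= r -> gammau i r <= gammamax r)
    (g : I -> I -> R) (g_ge0 : forall i j, 0 <= g i j)
    (gamma_linear : forall i j (r : R), 0 <= r -> gamma i j r = g i j * r)
    (Gamma : linfty R I -> linfty R I)
    (Gamma_def : is_gain_operator g Gamma)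
    (Gamma_radius : spectral_radius Gamma < 1) :
  ISS Sigma.
Proof.
have gain_ge0 := spectral_radius_subeigenvector g_ge0 Gamma_def Gamma_radius.
have [eta [lambda [C [/andP[lambda0 lambda1] C1 etaC geta]]]] := gain_ge0.
have [[Ssol _] _ SBIC] := Sigma_interconnection.
have C0 : 0 < C by exact: lt_le_trans C1.
have eta1 i : 1 <= eta i by have /andP[] := etaC i.
have eta0 i : 0 < eta i by exact: lt_le_trans (eta1 i).
apply: (@small_gain_ISS _ _ _ _ Sigma (weighted_norm eta) C lambda betamax gammamax) => //.
- exact: norm_le_weighted_norm.
- exact: weighted_norm_le_norm.
move=> t x u M dt VM; apply: (weighted_norm_le i0 etaC) => i.
have SM s : s%:num <= t%:num -> forall j, `|flow Sigma s x u j| <= eta j * M.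
  move=> st j; apply: le_trans (weighted_norm_ub etaC _ _) _.
  by rewrite ler_pM2l// VM.
apply: le_trans (interconnection_estimate Ssol (Sigma_ISS i) (g_ge0 i)
  (@gamma_linear i) eta0 (geta i) dt SM) _.
have b1 : beta i `|x i| t%:num <= betamax `|x| t%:num.
  apply: le_trans (beta_le _ _ _ _ _) _ => //.
  by apply: class_KL_le => //; exact: (bf_norm_ub x).
have g1 : gammau i `|u| <= gammamax `|u| by exact: gammau_le.
have b0 : 0 <= betamax `|x| t%:num by exact: class_KL_ge0.
have g0 : 0 <= gammamax `|u| by exact: class_K_ge0.
(* As [1 <= eta i], multiplying the nonnegative [betamax] and [gammamax] terms by [eta i] only
   enlarges them, while the [lambda] terms agree. *)
have e1 := eta1 i; nra.
Qed.
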